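(* Let $G$ be a finite, connected graph without loops. Fix a nonempty subset $Z\subseteq V(G)$ and an arithmetical structure $(\mathbf{d},\mathbf{r})$ on $G$. If each divisor on $G$ is equivalent (with respect to $\mathbf{d}$) to a divisor that is nonzero only at vertices in $Z$, then the critical group $\mathcal{K}(G;\mathbf{d},\mathbf{r})$ has at most $|Z|-1$ invariant factors.
   Context: Let $A(G)$ be the adjacency matrix of $G$. An arithmetical structure on $G$ is a pair $(\mathbf{d},\mathbf{r})$ with $\mathbf{d}\in\mathbb{Z}_{\ge0}^{V(G)}$, $\mathbf{r}\in\mathbb{Z}_{>0}^{V(G)}$ whose entries have no nontrivial common factor, and $(\operatorname{diag}(\mathbf{d})-A(G))\mathbf{r}=\mathbf{0}$. Write $L(G,\mathbf{d})=\operatorname{diag}(\mathbf{d})-A(G)$. The critical group $\mathcal{K}(G;\mathbf{d},\mathbf{r})$ is the torsion subgroup of the cokernel $\mathbb{Z}^{V(G)}/\operatorname{im}L(G,\mathbf{d})$ (this cokernel is isomorphic to $\mathbb{Z}\oplus\mathcal{K}(G;\mathbf{d},\mathbf{r})$). The number of invariant factors of a finite abelian group is the number of nontrivial cyclic factors in its invariant factor decomposition. A divisor is a vector $\delta\in\mathbb{Z}^{V(G)}$; two divisors are equivalent with respect to $\mathbf{d}$ if their difference lies in the image of $L(G,\mathbf{d})$ as a map $\mathbb{Z}^{V(G)}\to\mathbb{Z}^{V(G)}$ (i.e., one is obtained from the other by firing, which subtracts a column of $L(G,\mathbf{d})$, and borrowing, which adds one). *)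

(* Defs.v *)
From HB Require Import structures.
From mathcomp Require Import all_boot all_order all_algebra.
From mathcomp Require Import all_fingroup all_solvable generic_quotient.
From mathcomp Require Import boolp.

Set Implicit Arguments.
Unset Strict Implicit.
Unset Printing Implicit Defensive.

Import Order.TTheory GRing.Theory Num.Theory.
Local Open Scope ring_scope.

(* Parallel edges are allowed; an edge with two endpoints is not a loop. *)
Record multigraph := Multigraph {
  vertex : finType;
  edge : finType;
  endpoints : edge -> {set vertex};
  loopless : forall e, #|endpoints e| = 2%N
}.

Definition adjacency (G : multigraph) (u v : vertex G) : nat :=
  #|[set e : edge G | endpoints e == [set u; v]]|.

Definition connected (G : multigraph) : Prop :=
  (0 < #|vertex G|)%N /\
  forall u v : vertex G, connect (fun x y => (0 < adjacency x y)%N) u v.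

(* Integer matrices are indexed by a finite type rather than by an ordinal. *)
Definition mul_matvec (V : finType) (L : V -> V -> int) (x : {ffun V -> int}) :
  {ffun V -> int} := [ffun u => \sum_v L u v * x v].

Definition laplacian (G : multigraph) (d : {ffun vertex G -> nat})
    (u v : vertex G) : int :=
  (if u == v then (d u)%:Z else 0) - (adjacency u v)%:Z.

Record arithmetical_structure (G : multigraph) := ArithmeticalStructure {
  arith_d : {ffun vertex G -> nat};
  arith_r : {ffun vertex G -> nat};
  arith_r_gt0 : forall v, (0 < arith_r v)%N;
  arith_r_coprime : \big[gcdn/0%N]_v arith_r v = 1%N;
  arith_eq : mul_matvec (laplacian arith_d) [ffun v => (arith_r v)%:Z] = 0
}.

Section Cokernel.
Variables (V : finType) (L : V -> V -> int).

Definition image_of : {pred {ffun V -> int}} :=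
  fun y => `[< exists x, y = mul_matvec L x >].

Lemma mul_matvecB x y :
  mul_matvec L (x - y) = mul_matvec L x - mul_matvec L y.
Proof.
apply/ffunP => u; rewrite !ffunE -sumrB; apply: eq_bigr => v _.
by rewrite !ffunE mulrBr.
Qed.

Fact image_of_zmod_closed : zmod_closed image_of.
Proof.
split=> [|_ _ /asboolP[x ->] /asboolP[y ->]]; apply/asboolP.
  by exists 0; rewrite -[0 in RHS](subrr 0) mul_matvecB subrr.
by exists (x - y); rewrite mul_matvecB.
Qed.
HB.instance Definition _ :=
  GRing.isZmodClosed.Build {ffun V -> int} image_of image_of_zmod_closed.

Definition cokernel := Quotient.quot image_of.
HB.instance Definition _ := GRing.Zmodule.on cokernel.

Definition to_cokernel (x : {ffun V -> int}) : cokernel :=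
  \pi_(Quotient.quot image_of)%qT x.

Definition torsion : {pred cokernel} :=
  fun c => `[< exists n : nat, (0 < n)%N /\ c *+ n = 0 >].

Fact torsion_zmod_closed : zmod_closed torsion.
Proof.
split=> [|x y /asboolP[m [m0 xm]] /asboolP[n [n0 yn]]]; apply/asboolP.
  by exists 1%N; rewrite mul0rn.
exists (m * n)%N; rewrite muln_gt0 m0 n0; split=> //.
by rewrite mulrnBl mulrnA xm mulnC mulrnA yn !mul0rn subr0.
Qed.
HB.instance Definition _ :=
  GRing.isZmodClosed.Build cokernel torsion torsion_zmod_closed.

Record torsion_cokernel := TorsionCokernel {
  torsion_val :> cokernel;
  _ : torsion_val \in torsion
}.
HB.instance Definition _ := [isSub for torsion_val].
HB.instance Definition _ := [Choice of torsion_cokernel by <:].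
HB.instance Definition _ := [SubChoice_isSubZmodule of torsion_cokernel by <:].

Lemma to_cokernelMn x n : to_cokernel (x *+ n) = to_cokernel x *+ n.
Proof. by rewrite /to_cokernel raddfMn. Qed.

Lemma to_cokernelE x y :
  to_cokernel x = to_cokernel y <-> exists z, x - y = mul_matvec L z.
Proof.
have E : (x - y \in image_of) = (to_cokernel x == to_cokernel y).
  exact: (Quotient.idealrBE image_of x y).
split=> [/eqP|h]; first by rewrite -E => /asboolP.
by apply/eqP; rewrite -E; apply/asboolP.
Qed.

(* A torsion class has a representative with entries bounded by the row sums
   of |L|: if n * x = L y, subtract L (y %/ n) from x. *)
Lemma torsion_bounded (c : torsion_cokernel) :
  exists2 x : {ffun V -> int}, to_cokernel x = torsion_val c &
    forall u, `|x u| <= \sum_v `|L u v|.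
Proof.
case: c => c /= /asboolP[n [n0]].
have [x0 xc] : exists x, to_cokernel x = c by exists (repr c); exact: reprK.
rewrite -xc -to_cokernelMn => h.
have [y hy] : exists y, x0 *+ n = mul_matvec L y.
  have /to_cokernelE[y] : to_cokernel (x0 *+ n) = to_cokernel 0.
    by rewrite h /to_cokernel raddf0.
  by rewrite subr0; exists y.
have nz : n%:Z != 0 by rewrite -lt0n in n0 *; case: (n) n0.
pose q : {ffun V -> int} := [ffun v => (y v %/ n%:Z)%Z].
exists (x0 - mul_matvec L q).
  apply/to_cokernelE; exists (- q).
  by rewrite addrAC subrr sub0r -[- q]sub0r -[0 in RHS](subrr q) !mul_matvecB
             subrr sub0r.
move=> u; have nE : `|n%:Z| = n%:Z by [].
have n0' : 0 < n%:Z by [].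
rewrite -(ler_pM2r n0') -{1}nE -normrM.
have -> : (x0 - mul_matvec L q) u * n%:Z = \sum_v L u v * (y v %% n%:Z)%Z.
  move/ffunP: hy => /(_ u); rewrite ffunMnE !ffunE mulrBl -mulr_natr natz => ->.
  rewrite mulr_suml -sumrB; apply: eq_bigr => v _.
  by rewrite !ffunE -mulrA -mulrBr.
rewrite mulr_suml; apply: le_trans (ler_norm_sum _ _ _) _.
apply: ler_sum => v _; rewrite normrM ler_wpM2l //.
by rewrite ger0_norm ?modz_ge0 // ltW // ltz_pmod.
Qed.

Fact torsion_cokernel_finite :
  exists s : seq torsion_cokernel, forall c, c \in s.
Proof.
pose B := (\sum_u \sum_v `|L u v|)%N.
pose F (f : {ffun V -> 'I_(B + B).+1}) : option torsion_cokernel :=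
  insub (to_cokernel [ffun u => (f u : nat)%:Z - B%:Z]).
exists (pmap F (enum {: {ffun V -> 'I_(B + B).+1}})) => c.
have [x xc xB] := torsion_bounded c.
have {}xB u : `|x u| <= B%:Z.
  apply: le_trans (xB u) _.
  have -> : \sum_v `|L u v| = (\sum_v `|L u v|%N)%N%:Z.
    by rewrite -natz natr_sum; apply: eq_bigr => v _; rewrite natz.
  by rewrite lez_nat /B [leqRHS](bigD1 u) //= leq_addr.
pose f : {ffun V -> 'I_(B + B).+1} := [ffun u => inord (absz (x u + B%:Z))].
rewrite mem_pmap; apply/mapP; exists f; first by rewrite mem_enum.
rewrite /F (_ : [ffun u => _] = x); first by rewrite xc; exact/esym/valK.
apply/ffunP => u; rewrite !ffunE.
have := xB u; rewrite ler_norml => /andP[xl xr].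
have x0 : 0 <= x u + B%:Z by rewrite -lerBlDr sub0r.
rewrite inordK ?gez0_abs ?addrK //.
by rewrite ltnS -lez_nat gez0_abs // PoszD lerD2r.
Qed.

Let torsion_enum := undup (projT1 (cid torsion_cokernel_finite)).

Fact torsion_enumK :
  pcancel (fun c => index c torsion_enum) (onth torsion_enum).
Proof.
move=> c; rewrite onthE (nth_map c) ?nth_index ?index_mem //;
  by rewrite mem_undup; case: cid.
Qed.
HB.instance Definition _ :=
  Countable.copy torsion_cokernel (pcan_type torsion_enumK).

Fact torsion_cokernel_enumP : Finite.axiom torsion_enum.
Proof.
by apply: Finite.uniq_enumP (undup_uniq _) _ => c;
  rewrite mem_undup inE; case: cid => s /= ->.
Qed.
HB.instance Definition _ :=
  isFinite.Build torsion_cokernel torsion_cokernel_enumP.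

End Cokernel.

Definition critical_group (G : multigraph) (S : arithmetical_structure G) :
  finZmodType := torsion_cokernel (laplacian (arith_d S)).

(* [abelian_type] lists the orders, all greater than 1 and each divisible by
   the next, of the cyclic factors in the invariant factor decomposition. *)
Definition num_invariant_factors (A : finZmodType) : nat :=
  size (abelian_type [set: A]).

Notation divisor G := {ffun vertex G -> int}.

Definition divisor_equiv (G : multigraph) (d : {ffun vertex G -> nat})
    (D D' : divisor G) : Prop :=
  exists x : divisor G, D - D' = mul_matvec (laplacian d) x.

(* Main.v *)
Require Import Defs.
From HB Require Import structures.
From mathcomp Require Import all_boot all_order all_algebra.
From mathcomp Require Import all_fingroup all_solvable.
From mathcomp Require Import boolp.

(** Pairing with [r] gives a degree map from the cokernel to the integers; it is
    surjective because the entries of [r] are coprime, and it vanishes on the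
    critical group [K].  Choose a prime [p] such that [K] and [K / pK] have the
    same rank, and a divisor [E] of degree 1.  The degree shows that
    [(a, t) |-> a E + t] embeds [Z/p * K/pK] into the cokernel modulo [p], whose
    elements are determined by the residues modulo [p] of the values on [Z] of
    a representative.  Counting gives [p ^ (1 + rank K) <= p ^ #|Z|]. *)

Set Implicit Arguments.
Unset Strict Implicit.
Unset Printing Implicit Defensive.

Import GRing.Theory Num.Theory.

(** Some elementary abelian [p]-subgroup has order [p ^ 'r_p(G)]. The [p]-th power map kills it, so
    it lies in ['ker f], whose order is the index of the image. *)
Lemma p_rank_leq_index (gT : finGroupType) (G : {group gT})
    (f : {morphism G >-> gT}) (p : nat) :
  (f @* G \subset G)%g -> {in G, forall x, f x = x ^+ p}%g -> prime p ->
  p ^ 'r_p(G)%g <= #|G : (f @* G)%g|%g.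
Proof.
move=> fG fE pr.
have [E /pnElemP[EG abelE <-]] := p_rank_witness p G.
have [_ Ep] := abelemP pr abelE.
rewrite -(card_pgroup (abelem_pgroup abelE)).
rewrite -(@leq_pmul2l #|(f @* G)%g|) ?cardG_gt0 // Lagrange //.
rewrite card_morphim setIid -(Lagrange (subsetIl G _ : ('ker f \subset G)%g)).
rewrite mulnC leq_mul2r subset_leq_card ?orbT //.
apply/fintype.subsetP => x xE; have xG := subsetP EG x xE.
by apply/kerP => //; rewrite fE // Ep.
Qed.

(** The multiples of [p] form a subgroup of index at least [p ^ 'r_p([set: A])]. Evaluating [f] at
    one representative per coset is injective on [U] times the cosets, even if [f] is not constant
    on cosets. *)
Lemma card_mul_p_rank_leq (A : finZmodType) (U T : finType) (p : nat)
    (f : U -> A -> T) :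
  prime p ->
  (forall a b x y, f a x = f b y -> a = b /\ exists z, x - y = z *+ p)%R ->
  #|U| * p ^ 'r_p([set: A])%g <= #|T|.
Proof.
move=> pr f_inj.
have mulpM :
    {in [set: A] &, {morph (fun x : A => x *+ p)%R : x y / (x * y)%g}}.
  by move=> x y _ _; rewrite !FinRing.zmodMgE mulrnDl.
pose H := (Morphism mulpM @* [set: A])%G.
pose C : finType := {B : {set A} | B \in rcosets H [set: A]}.
have le_index : p ^ 'r_p([set: A])%g <= #|[set: A] : H|%g.
  by apply: p_rank_leq_index => //= x _; rewrite FinRing.zmodXgE.
apply: leq_trans (leq_mul (leqnn _) le_index) _.
have -> : #|[set: A] : H|%g = #|C| by rewrite card_sig.
rewrite -card_prod; pose g (u : U * C) := f u.1 (repr (val u.2)).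
apply: (@leq_card _ _ g) => -[a [B hB]] [b [D hD]].
rewrite /g /= => /f_inj[-> [z hz]]; congr (_, _); apply: val_inj => /=.
case/rcosetsP: hB hz => x _ ->; case/rcosetsP: hD => y _ -> hz.
rewrite -(rcoset_repr H x) -(rcoset_repr H y); apply/rcoset_eqP/rcosetP.
exists (z *+ p)%R; last by rewrite FinRing.zmodMgE -hz subrK.
by apply/morphimP; exists z; rewrite ?inE.
Qed.

Section Degree.
Local Open Scope ring_scope.

Definition degree (V : finType) (r : V -> nat) (x : {ffun V -> int}) : int :=
  \sum_v (r v)%:Z * x v.

Lemma degreeB (V : finType) (r : V -> nat) : {morph degree r : x y / x - y}.
Proof.
move=> x y; rewrite /degree -sumrB; apply: eq_bigr => v _.
by rewrite !ffunE mulrBr.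
Qed.
HB.instance Definition _ (V : finType) (r : V -> nat) :=
  GRing.isZmodMorphism.Build {ffun V -> int} int (degree r) (@degreeB V r).

(** Bezout coefficients combine two witnesses; a single vertex is served by its indicator. *)
Lemma degree_gcd (V : finType) (r : V -> nat) :
  exists x, degree r x = (\big[gcdn/0%N]_v r v)%:Z.
Proof.
apply: (big_ind (fun n => exists x, degree r x = n%:Z)).
- by exists 0; rewrite raddf0.
- move=> m n [x xm] [y yn]; have [a [b ab]] := Bezoutz m n.
  exists (x *~ a + y *~ b); rewrite raddfD !raddfMz /= xm yn !mulrzz.
  by rewrite ![_%:Z * _]mulrC.
move=> v _; exists [ffun u => (u == v)%:Z]; rewrite /degree (bigD1 v) //=.
rewrite ffunE eqxx mulr1 big1 ?addr0 // => u /negPf uv.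
by rewrite ffunE uv mulr0.
Qed.

Lemma laplacianC (G : multigraph) (d : {ffun vertex G -> nat}) u v :
  laplacian d u v = laplacian d v u.
Proof. by rewrite /laplacian /adjacency setUC eq_sym; case: eqP => [->|]. Qed.

Variables (G : multigraph) (S : arithmetical_structure G).
Let L := laplacian (arith_d S).

(** [L] is symmetric and kills [r] on the right, hence also on the left. *)
Lemma degree_image x : degree (arith_r S) (mul_matvec L x) = 0.
Proof.
rewrite /degree; under eq_bigr => v _ do rewrite ffunE mulr_sumr.
rewrite exchange_big big1 // => v _.
have := congr1 (fun f : {ffun _ -> int} => f v * x v) (arith_eq S).
rewrite !ffunE mul0r mulr_suml => h; rewrite -[RHS]h.
by apply: eq_bigr => u _; rewrite ffunE /L laplacianC mulrCA mulrA.
Qed.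

(** The degree factors through the cokernel, and the integers are torsion-free. *)
Lemma degree_torsion x :
  to_cokernel L x \in @torsion _ L -> degree (arith_r S) x = 0.
Proof.
move=> /asboolP[n [n_gt0]]; rewrite -to_cokernelMn => h.
have /to_cokernelE[y] : to_cokernel L (x *+ n) = to_cokernel L 0.
  by rewrite h /to_cokernel raddf0.
rewrite subr0 => /(congr1 (degree (arith_r S))).
rewrite degree_image raddfMn /=.
by move/eqP; rewrite mulrn_eq0 eqn0Ngt n_gt0 => /eqP.
Qed.

End Degree.

Section CriticalGroup.
Local Open Scope ring_scope.

Lemma Fp_int_eq (p : nat) (m n : int) : prime p ->
  m%:~R = n%:~R :> 'F_p -> exists q, m - n = q * p%:Z.
Proof.
move=> pr /eqP; rewrite -subr_eq0 -intrB -(dvdz_pcharf (pchar_Fp pr)).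
by move/dvdzP.
Qed.

Lemma p_rank_critical_group (G : multigraph) (Z : {set vertex G})
    (S : arithmetical_structure G) (p : nat) :
  (forall D : divisor G, exists D' : divisor G,
     divisor_equiv (arith_d S) D D' /\
     (forall v : vertex G, D' v <> 0 -> v \in Z)) ->
  prime p -> ('r_p([set: critical_group S])%g < #|Z|)%N.
Proof.
move=> Zgen pr; set L := laplacian (arith_d S).
have [E degE] := degree_gcd (arith_r S); rewrite arith_r_coprime in degE.
have [red redP] := choice Zgen.
have /choice[rep repK] (x : critical_group S) :
    exists D, to_cokernel L D = torsion_val x.
  by have [D DK _] := torsion_bounded x; exists D.
(* Here [a] is read as its representative between 0 and [p - 1], which is then exactly the degree of
   the lift. *)
pose lift (a : 'F_p) (x : critical_group S) : divisor G := rep x + E *+ a.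
pose f a x : {ffun {v | v \in Z} -> 'F_p} :=
  [ffun v => (red (lift a x) (val v))%:~R].
have deg_lift a x : degree (arith_r S) (lift a x) = a%:Z.
  rewrite raddfD raddfMn /= degE degree_torsion ?add0r ?natz //.
  by rewrite repK; exact: (valP x).
suff: (p * p ^ 'r_p([set: critical_group S])%g <= p ^ #|Z|)%N.
  by rewrite -expnS leq_exp2l ?prime_gt1.
have -> : (p ^ #|Z| = #|{ffun {v | v \in Z} -> 'F_p}|)%N.
  by rewrite card_ffun card_Fp // card_sig.
rewrite -[X in (X * _)%N](card_Fp pr).
apply: (@card_mul_p_rank_leq _ _ _ _ f) => // a b x y fab.
(* On [Z] the residues agree; off [Z] both reduced divisors vanish. *)
have [Q hQ] : exists Q, red (lift a x) - red (lift b y) = Q *+ p.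
  have /choice[Q hQ] v : exists q, red (lift a x) v - red (lift b y) v = q *+ p.
    have [vZ|vZ] := boolP (v \in Z).
      have /ffunP/(_ (Sub v vZ)) := fab; rewrite !ffunE /=.
      by move=> /(Fp_int_eq pr)[q ->]; exists q; rewrite -mulr_natr natz.
    exists 0; rewrite mul0rn.
    have red0 D : red D v = 0.
      by apply: contraNeq vZ => /eqP; case: (redP D) => _; exact.
    by rewrite !red0 subr0.
  exists [ffun v => Q v]; apply/ffunP => v.
  by have := hQ v; rewrite ffunMnE !ffunE.
have [[w hw] _] := redP (lift a x); have [[w' hw'] _] := redP (lift b y).
have liftB : lift a x - lift b y = Q *+ p + mul_matvec L (w - w').
  move: hw hw' => /eqP + /eqP; rewrite !subr_eq => /eqP hw /eqP hw'.
  by rewrite {1}hw {1}hw' opprD addrACA -mul_matvecB hQ addrC.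
(* Taking degrees removes the image of [L], so [a - b] is [p] times the degree of [Q]. *)
have := congr1 (degree (arith_r S)) liftB.
rewrite degreeB !deg_lift raddfD raddfMn /= degree_image addr0 => degQ.
have ab : a = b.
  apply/eqP; rewrite -subr_eq0 -[a]natr_Zp -[b]natr_Zp !pmulrn -intrB degQ.
  by rewrite rmorphMn /= -mulr_natr pcharf0 ?pchar_Fp ?mulr0.
split=> //; move: liftB; rewrite /lift ab opprD addrACA subrr addr0 => repB.
have QE : to_cokernel L (rep x - rep y) = to_cokernel L Q *+ p.
  rewrite -to_cokernelMn; apply/to_cokernelE; exists (w - w').
  by rewrite repB addrAC subrr add0r.
(* The quotient of [x - y] by [p] must lie in the critical group, not just in the cokernel: if [n]
   kills [x - y], then [p * n] kills the class of [Q]. *)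
have tQ : to_cokernel L Q \in @torsion _ L.
  have /asboolP[n [n_gt0 nxy]] := valP (x - y); apply/asboolP.
  exists (p * n)%N; rewrite muln_gt0 prime_gt0 // mulrnA -QE; split=> //.
  by rewrite -[RHS]nxy /to_cokernel !raddfB /= -!repK.
exists (Sub (to_cokernel L Q) tQ); apply: val_inj.
by rewrite raddfB raddfMn /= -!repK -QE /to_cokernel raddfB.
Qed.

End CriticalGroup.

Theorem theorem2p4 (G : multigraph) (Z : {set vertex G})
    (S : arithmetical_structure G) :
  connected G ->
  Z != set0 ->
  (forall D : divisor G, exists D' : divisor G,
     divisor_equiv (arith_d S) D D' /\
     (forall v : vertex G, D' v <> 0%R -> v \in Z)) ->
  num_invariant_factors (critical_group S) <= #|Z| - 1.
Proof.
move=> _ _ Zgen; rewrite /num_invariant_factors.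
rewrite size_abelian_type ?FinRing.zmod_abelian //.
have [p pr ->] := rank_witness [set: critical_group S]%G.
(* The strict bound makes [#|Z|] positive, so the truncated subtraction is exact. *)
by rewrite subn1 -ltnS (ltn_predK (p_rank_critical_group Zgen pr))
  p_rank_critical_group.
Qed.
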